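(* Let $n \geq 2$ be an integer and let $f(x) \in \mathbb{C}[x]$ be monic and separable of degree $n$. Then \[\operatorname{sep}(f) \leq \min\left\{2,\frac{34}{\sqrt{n}}\right\}M(f)^{1/(n-1)}.\] If, in addition, $f(x) \in \mathbb{R}[x]$ and at least one of the complex roots of $f(x)$ of minimum absolute value (among all roots of $f$) is not real (for example, if $f(x) \in \mathbb{R}[x]$ has no real roots), then \[\operatorname{sep}(f) \leq \min\left\{2,\frac{34}{\sqrt{n}}\right\} M(f)^{1/n}.\]
   Context: For a polynomial $f(x)\in\mathbb{C}[x]$ with roots $\alpha_1,\dots,\alpha_n\in\mathbb{C}$, the separation of $f$ is $\operatorname{sep}(f) := \min_{\alpha_i\neq\alpha_j}|\alpha_i-\alpha_j|$. For a monic polynomial $f(x)\in\mathbb{C}[x]$ with roots $\alpha_1,\dots,\alpha_n$ (with multiplicity), the Mahler measure of $f$ is $M(f) := \prod_{i=1}^n\max\{1,|\alpha_i|\}$. Separable means that $f$ has $n=\deg f$ distinct complex roots. *)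

(* Defs.v *)
From mathcomp Require Import all_boot all_order all_algebra.
From mathcomp Require Import complex.
From mathcomp Require Import all_classical all_reals all_analysis.

Set Implicit Arguments.
Unset Strict Implicit.
Unset Printing Implicit Defensive.

Import Order.TTheory GRing.Theory Num.Theory.
Local Open Scope ring_scope.

Section RootInvariants.
Variable R : realType.
Implicit Type f : {poly R[i]}.

(* The roots of [f], listed with multiplicity ([closed_field_poly_normal] only
   determines them up to order, on which nothing below depends).             *)
Definition croots f : seq R[i] := sval (closed_field_poly_normal f).

Definition separable_C f : Prop := size (undup (croots f)) = (size f).-1.

Definition root_dists f : seq R :=
  [seq Normc.normc (ab.1 - ab.2)
     | ab <- [seq (a, b) | a <- croots f, b <- croots f] & ab.1 != ab.2].

(* The neutral element of the iterated minimum is itself one of the distances,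
   so this is the true minimum as soon as [f] has two distinct roots; it takes
   the junk value 0 otherwise.                                               *)
Definition sep f : R :=
  \big[Num.min/head 0 (root_dists f)]_(d <- root_dists f) d.

(* For monic [f] only: there is no factor for the leading coefficient. *)
Definition mahler f : R := \prod_(a <- croots f) Num.max 1 (Normc.normc a).

Definition min_abs_root f (a : R[i]) : Prop :=
  root f a /\ forall b, root f b -> Normc.normc a <= Normc.normc b.

End RootInvariants.

(* Main.v *)
(* Order the roots by modulus, [|t_0| <= ... <= |t_(n-1)|], and let [d = sep f].
   The first [i+1] roots are [d]-separated points of the disc of radius [|t_i|],
   so [(i+1) d^2 <= 36 |t_i|^2] as soon as [d <= 2 |t_i|].  The latter holds for
   [i >= 1], since [d <= |t_0| + |t_1|], and also for [i = 0] when [f] is real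
   with a non-real root of minimum modulus, since [t_0] then has the modulus of
   two distinct conjugate roots.  Multiplying over [m <= i < n] with [m = 1],
   resp. [m = 0], gives [n! d^(2(n-m)) <= 36^(n-m) M(f)^2], and [n!] is compared
   with [n^(n-m)] through [n^n <= (2n)!/n! = 'C(2n, n) n! <= 4^n n!]. *)

Require Import Defs.
From mathcomp Require Import all_boot all_order all_algebra.
From mathcomp Require Import complex.
From mathcomp Require Import all_classical all_reals all_analysis.
From mathcomp Require Import ring lra zify.

Import Order.TTheory GRing.Theory Num.Theory.
Local Open Scope ring_scope.

(** * Comparison of powers of [n] with [n!] *)

Lemma expnn_le_fact (n : nat) : (n ^ n <= 4 ^ n * n`!)%N.
Proof.
have le_ffact : (n ^ n <= (n + n) ^_ n)%N.
  (* Factor by factor: [n + n - i >= n] for each [i < n]. *)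
  rewrite ffact_prod -[X in (n ^ X)%N](card_ord n) -prod_nat_const.
  by apply: leq_prod => i _; have := ltn_ord i; lia.
have le_bin : ('C(n + n, n) <= 4 ^ n)%N.
  (* The binomial coefficient is one term of the expansion of [(1 + 1) ^ (n + n)]. *)
  rewrite -[4%N]/(2 ^ 2)%N -expnM mulSn mul1n -[2%N]/(1 + 1)%N Pascal.
  rewrite (bigD1 (inord n)) //= inordK ?ltnS ?leq_addr // !exp1n !muln1.
  exact: leq_addr.
by rewrite (leq_trans le_ffact) // -bin_ffact leq_mul2r le_bin orbT.
Qed.

(** Here [n <= 2 * (n - m)], so [4 ^ n <= 16 ^ (n - m)]. The base 32 is the largest integer [c] with
    [36 * c <= 34 ^ 2], which is how the final constant 34 absorbs it. *)
Lemma expn_subn_le_fact (m n : nat) : (m <= 1)%N -> (2 <= n)%N ->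
  (n ^ (n - m) <= 32 ^ (n - m) * n`!)%N.
Proof.
move=> m_le1 n_ge2.
have le_nn : (n ^ (n - m) <= n ^ n)%N by rewrite leq_pexp2l //; lia.
rewrite (leq_trans (leq_trans le_nn (expnn_le_fact n))) // leq_mul2r.
apply/orP; right; apply: (@leq_trans (4 ^ (2 * (n - m)))).
  by rewrite leq_pexp2l //; lia.
by rewrite expnM leq_exp2r //; lia.
Qed.

Lemma ler_prod_nat (R : numDomainType) (m n : nat) (F G : nat -> R) :
  (forall i, (m <= i < n)%N -> 0 <= F i <= G i) ->
  \prod_(m <= i < n) F i <= \prod_(m <= i < n) G i.
Proof. by move=> leFG; rewrite big_nat [leRHS]big_nat ler_prod. Qed.

(** * Packing of separated points, and the bound for a list sorted by modulus *)

Section Modulus.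
Variable R : realType.
Implicit Types x y z : R[i].
Local Notation normc := (@Normc.normc R).

Lemma normc_ge0 z : 0 <= normc z.
Proof. by case: z => a b; apply: sqrtr_ge0. Qed.

Lemma sqr_normcE z : normc z ^+ 2 = complex.Re z ^+ 2 + complex.Im z ^+ 2.
Proof. by case: z => a b; rewrite sqr_sqrtr // addr_ge0 ?sqr_ge0. Qed.

Lemma normcB_le x y : normc (x - y) <= normc x + normc y.
Proof. by rewrite -(normcN y); apply: (le_normcD x (- y)). Qed.

Lemma normc_conj z : normc (conjc z) = normc z.
Proof. by case: z => a b /=; rewrite sqrrN. Qed.

(* Pigeonhole on a square grid of mesh [d / 2] covering the disc. *)
Lemma disc_packing (t : seq R[i]) (d r : R) :
  0 < d -> d <= 2 * r -> uniq t -> {in t, forall z, normc z <= r} ->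
  {in t &, forall x y, x != y -> d <= normc (x - y)} ->
  (size t)%:R * d ^+ 2 <= 36 * r ^+ 2.
Proof.
move=> d_gt0 d_le2r t_uniq t_le t_sep.
pose a := d / 2; have a_gt0 : 0 < a by rewrite divr_gt0.
pose N := Num.truncn (2 * r / a).
(* For [|u| <= r] the shifted coordinate [u + r] lies in [[0, 2 * r]], so its index is at most [N]
   and [inord] does not fall back to its default. *)
pose cell (u : R) : 'I_N.+1 := inord (Num.truncn ((u + r) / a)).
have cellE (u v : R) : `|u| <= r -> `|v| <= r -> cell u = cell v ->
    (u - v) ^+ 2 < a ^+ 2.
  have truncE w : `|w| <= r ->
      (cell w)%:R * a <= w + r < (cell w).+1%:R * a.
    rewrite ler_norml => /andP[ge_r le_r].
    have wr_ge0 : 0 <= (w + r) / a by rewrite divr_ge0 ?(ltW a_gt0) //; lra.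
    rewrite -ler_pdivlMr // -ltr_pdivrMr // /cell inordK; first exact: truncn_itv.
    by rewrite ltnS le_truncn // ler_pM2r ?invr_gt0 //; lra.
  move=> /truncE/andP[lu uu] /truncE/andP[lv uv] cuv.
  rewrite cuv -natr1 mulrDl mul1r in lu uu; rewrite -natr1 mulrDl mul1r in uv.
  have duv : -a < u - v < a by apply/andP; split; lra.
  rewrite -real_normK ?num_real // ltr_pXn2r ?nnegrE ?(ltW a_gt0) //.
  by rewrite ltr_norml.
pose F z := (cell (complex.Re z), cell (complex.Im z)).
have F_inj : {in t &, injective F}.
  move=> x y xt yt [eq_re eq_im]; apply/eqP; apply: contraT => neq_xy.
  have bound z : z \in t -> `|complex.Re z| <= r /\ `|complex.Im z| <= r.
    move=> /t_le z_le; have r_ge0 := le_trans (normc_ge0 z) z_le.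
    have : normc z ^+ 2 <= r ^+ 2 by rewrite ler_pXn2r ?nnegrE ?normc_ge0.
    rewrite sqr_normcE => z2_le.
    by split; rewrite -(@ler_pXn2r _ 2) ?nnegrE // real_normK ?num_real //;
      apply: le_trans z2_le; rewrite ?lerDl ?lerDr sqr_ge0.
  have [[xr xi] [yr yi]] := (bound _ xt, bound _ yt).
  (* Points in one cell have squared distance below [2 * (d / 2) ^ 2 = d ^ 2 / 2], against
     separation. *)
  have := cellE _ _ xr yr eq_re; have := cellE _ _ xi yi eq_im.
  have : d ^+ 2 <= normc (x - y) ^+ 2.
    by rewrite ler_pXn2r ?nnegrE ?normc_ge0 ?t_sep // ltW.
  rewrite sqr_normcE /a !raddfB /=.
  have : 0 < d ^+ 2 by rewrite exprn_gt0.
  lra.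
have size_t : (size t <= N.+1 * N.+1)%N.
  rewrite -(size_map F) -(card_uniqP _) ?map_inj_in_uniq //.
  by rewrite (leq_trans (max_card _)) // card_prod !card_ord.
have N_le : N%:R <= 2 * r / a.
  have ra_ge0 : 0 <= 2 * r / a by rewrite divr_ge0 ?(ltW a_gt0) //; lra.
  by have /andP[] := truncn_itv ra_ge0.
(* Source of 36: [N * d <= 4 * r], and the extra [d] is at most [2 * r]. *)
have Nd_le : N.+1%:R * d <= 6 * r.
  move: N_le; rewrite ler_pdivlMr // /a mulrA -(natr1 N) mulrDl mul1r; lra.
have -> : 36 * r ^+ 2 = (6 * r) ^+ 2 by ring.
apply: (@le_trans _ _ ((N.+1%:R * d) ^+ 2)).
  rewrite exprMn ler_pM2r ?exprn_gt0 // -natrX ler_nat expnS expn1 //.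
by rewrite ler_pXn2r ?nnegrE ?mulr_ge0 // ?(ltW d_gt0) //; lra.
Qed.


Lemma prod_nth_le (t : seq R[i]) (m : nat) : (m <= size t)%N ->
  \prod_(m <= i < size t) normc t`_i <= \prod_(a <- t) Num.max 1 (normc a).
Proof.
move=> m_le; rewrite [leRHS](big_nth 0) [leRHS](big_cat_nat (n := m)) //=.
have max_ge1 i : 1 <= Num.max 1 (normc t`_i) by rewrite le_max lexx.
apply: (@le_trans _ _ (\prod_(m <= i < size t) Num.max 1 (normc t`_i))).
  by apply: ler_prod => i _; rewrite normc_ge0 le_max lexx orbT.
rewrite ler_peMl //.
  by apply: prodr_ge0 => i _; apply: le_trans (max_ge1 i).
by elim/big_ind: _ => // x y x_ge1 y_ge1; rewrite mulr_ege1.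
Qed.

Lemma sorted_normc_nth (t : seq R[i]) (i j : nat) :
  sorted (relpre normc <=%O) t -> (i <= j)%N -> (j < size t)%N ->
  normc t`_i <= normc t`_j.
Proof.
move=> t_sorted le_ij lt_j.
have le_tr : transitive (relpre normc <=%O) by move=> x y z; apply: le_trans.
have le_refl : reflexive (relpre normc <=%O) by move=> x; apply: lexx.
apply: (sorted_leq_nth le_tr le_refl 0 t_sorted) => //.
by rewrite inE (leq_ltn_trans le_ij).
Qed.

Lemma le_mul_powR_inv (k : nat) (d c Q : R) : (0 < k)%N -> 0 <= d -> 0 <= c ->
  0 <= Q -> d ^+ k <= c ^+ k * Q -> d <= c * Q `^ k%:R^-1.
Proof.
move=> k_gt0 d_ge0 c_ge0 Q_ge0 le_dk.
rewrite -(@ler_pXn2r _ k) ?nnegrE ?mulr_ge0 ?powR_ge0 // exprMn.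
rewrite -[X in _ * X]powR_mulrn ?powR_ge0 // -powRrM mulVf ?powRr1 //.
by rewrite pnatr_eq0 -lt0n.
Qed.

(** Serves both bounds: [m = 1] yields the exponent [1 / (n - 1)] and [m = 0] yields [1 / n].
    Sorting propagates the hypothesis on [t_m] to every later entry. *)
Lemma separation_le (t : seq R[i]) (m : nat) (d : R) :
  (m <= 1)%N -> (2 <= size t)%N -> uniq t ->
  sorted (relpre normc <=%O) t ->
  {in t &, forall x y, x != y -> d <= normc (x - y)} ->
  d <= 2 * normc t`_m ->
  d <= Num.min 2 (34 / Num.sqrt (size t)%:R) *
       (\prod_(a <- t) Num.max 1 (normc a)) `^ (size t - m)%:R^-1.
Proof.
move=> m_le1 n_ge2 t_uniq t_sorted t_sep d_le.
set n := size t; set k := (n - m)%N; set Q := \prod_(a <- t) _.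
have Q_ge0 : 0 <= Q by apply: prodr_ge0 => a _; rewrite le_max ler01.
have [d_le0|d_gt0] := leP d 0.
  by rewrite (le_trans d_le0) ?mulr_ge0 ?powR_ge0 // le_min ler0n divr_ge0 ?sqrtr_ge0.
have d_ge0 := ltW d_gt0.
have k_gt0 : (0 < k)%N by rewrite subn_gt0 (leq_ltn_trans m_le1).
have m_le : (m <= n)%N by rewrite ltnW // -subn_gt0.
have t_mono i j : (i <= j)%N -> (j < n)%N -> normc t`_i <= normc t`_j.
  exact: sorted_normc_nth.
have tail_ge i : (m <= i < n)%N -> d <= 2 * normc t`_i.
  by case/andP=> le_mi lt_in; rewrite (le_trans d_le) // ler_pM2l // t_mono.
have tail_sqr_ge i : (m <= i < n)%N -> i.+1%:R * d ^+ 2 <= 36 * normc t`_i ^+ 2.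
  move=> mi; have /andP[_ lt_in] := mi.
  have <- : size (take i.+1 t) = i.+1 by rewrite size_takel.
  apply: disc_packing => //; first exact: tail_ge.
  - exact: take_uniq.
  - move=> z /(nthP 0)[j]; rewrite size_takel // => lt_ji <-.
    by rewrite nth_take // t_mono.
  - by move=> x y /mem_take xt /mem_take yt; apply: t_sep.
pose W := \prod_(m <= i < n) normc t`_i.
have W_ge0 : 0 <= W by apply: prodr_ge0 => i _; apply: normc_ge0.
have WQ : W <= Q by apply: prod_nth_le.
have le_dk : d ^+ k <= 2 ^+ k * W.
  rewrite -!prodr_const_nat -big_split /=; apply: ler_prod_nat => i mi.
  by rewrite d_ge0 tail_ge.
(* For [m = 1] the missing factor of [n!] is 1, so both values of [m] give the full factorial. *)
have prod_succ : \prod_(m <= i < n) i.+1%:R = n`!%:R :> R.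
  rewrite fact_prod big_add1 /= natr_prod.
  case: (m) m_le1 => [|[|//]] _ //.
  by rewrite [RHS]big_ltn ?mul1r // (leq_trans _ n_ge2).
have le_d2k : n`!%:R * (d ^+ 2) ^+ k <= 36 ^+ k * W ^+ 2.
  rewrite -prod_succ -!prodr_const_nat /W -prodrXl -!big_split /=.
  apply: ler_prod_nat => i mi; rewrite tail_sqr_ge // andbT.
  by rewrite mulr_ge0 ?sqr_ge0.
have sqrtn_gt0 : 0 < Num.sqrt n%:R :> R by rewrite sqrtr_gt0 ltr0n ltnW.
rewrite minEle; case: ifP => _.
  apply: le_mul_powR_inv => //; apply: le_trans le_dk _.
  by rewrite ler_pM2l ?exprn_gt0.
apply: le_mul_powR_inv => //.
rewrite expr_div_n mulrAC ler_pdivlMr ?exprn_gt0 // -exprMn.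
have dn_ge0 : 0 <= d * Num.sqrt n%:R by rewrite mulr_ge0 ?sqrtr_ge0.
(* Squaring removes [Num.sqrt n] and makes both [le_d2k] and the factorial bound applicable. *)
rewrite -(@ler_pXn2r _ 2) ?nnegrE ?(mulr_ge0 _ Q_ge0) ?exprn_ge0 //.
rewrite exprAC [(d * _) ^+ 2]exprMn sqr_sqrtr // exprMn [leRHS]exprMn [X in _ <= X * _]exprAC.
(* Numerically, [32 * 36 = 1152 <= 1156 = 34 ^ 2]. *)
apply: (@le_trans _ _ ((32 * 36) ^+ k * W ^+ 2)); last first.
  apply: ler_pM; rewrite ?exprn_ge0 ?sqr_ge0 //.
    by rewrite ler_pXn2r ?nnegrE //; lra.
  by rewrite ler_pXn2r ?nnegrE.
rewrite [(32 * 36) ^+ k]exprMn -mulrA.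
apply: (@le_trans _ _ (32 ^+ k * (n`!%:R * (d ^+ 2) ^+ k))); last first.
  by rewrite ler_pM2l ?exprn_gt0.
rewrite mulrC mulrA ler_wpM2r ?exprn_ge0 ?sqr_ge0 //.
by rewrite -!natrX -natrM ler_nat expn_subn_le_fact.
Qed.

End Modulus.

(** * Roots of a monic polynomial and their conjugates *)

Section Roots.
Variable R : realType.
Implicit Type f : {poly R[i]}.
Local Notation normc := (@Normc.normc R).

Lemma monic_croots f : f \is monic -> f = \prod_(a <- croots f) ('X - a%:P).
Proof.
move=> /monicP f_lead; rewrite /croots.
by case: closed_field_poly_normal => s /= {1}->; rewrite f_lead scale1r.
Qed.

Lemma sep_le f : {in croots f &, forall a b, a != b -> sep f <= normc (a - b)}.
Proof.
move=> a b fa fb neq_ab; apply: ge_bigmin_seq => //.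
apply/mapP; exists (a, b) => //; rewrite mem_filter neq_ab.
by apply/allpairsP; exists (a, b).
Qed.

Lemma root_conjc f a : f \is a polyOver Num.real -> root f a -> root f (conjc a).
Proof.
move=> /polyOverP f_real; rewrite -complex_root_conj.
suff -> : map_poly conjc f = f by [].
apply/polyP => j; rewrite coef_map /=.
by have /complex_realP[c ->] := f_real j; rewrite conjc_real.
Qed.

End Roots.

Theorem theorem1p2 (R : realType) (n : nat) (f : {poly R[i]}) :
  (2 <= n)%N -> f \is monic -> size f = n.+1 -> separable_C f ->
  sep f <= Num.min 2 (34 / Num.sqrt n%:R) * mahler f `^ (n.-1%:R^-1)
  /\ (f \is a polyOver Num.real ->
      (exists a : R[i], min_abs_root f a /\ a \isn't Num.real) ->
      sep f <= Num.min 2 (34 / Num.sqrt n%:R) * mahler f `^ (n%:R^-1)).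
Proof.
move=> n_ge2 f_monic f_size f_sep.
have fE := monic_croots _ _ f_monic.
have r_size : size (croots f) = n.
  by apply: succn_inj; rewrite -f_size [in RHS]fE size_prod_XsubC.
have r_uniq : uniq (croots f).
  (* A repeated root would make [undup] strictly shorter than [n], against separability. *)
  apply: contraT; rewrite -ltn_size_undup => /[dup].
  by move: f_sep; rewrite /separable_C f_size /= r_size => ->; rewrite ltnn.
pose t := sort (relpre (@Normc.normc R) <=%O) (croots f).
have t_size : size t = n by rewrite size_sort.
have t_uniq : uniq t by rewrite sort_uniq.
have mem_t : t =i croots f by apply: mem_sort.
have t_sorted : sorted (relpre (@Normc.normc R) <=%O) t.
  by apply: sort_sorted => x y /=; apply: le_total.
have t_sep : {in t &, forall x y, x != y -> sep f <= Normc.normc (x - y)}.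
  by move=> x y; rewrite !mem_t; apply: sep_le.
have mahlerE : mahler f = \prod_(a <- t) Num.max 1 (Normc.normc a).
  by apply: perm_big; rewrite perm_sym perm_sort.
have t_root a : (a \in t) = root f a.
  by rewrite mem_t [in RHS]fE root_prod_XsubC.
rewrite mahlerE -t_size; split.
  rewrite -subn1; apply: separation_le; rewrite ?t_size //.
  (* With [m = 1]: the distance from [t_0] to [t_1] is at most [|t_0| + |t_1| <= 2 * |t_1|]. *)
  have t0 : t`_0 \in t by rewrite mem_nth // t_size ltnW.
  have t1 : t`_1 \in t by rewrite mem_nth // t_size.
  have t01 : t`_0 != t`_1 by rewrite nth_uniq // t_size // ltnW.
  apply: le_trans (t_sep _ _ t0 t1 t01) _; apply: le_trans (normcB_le _ _ _) _.
  rewrite mulrDl mul1r lerD2r.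
  by apply: sorted_normc_nth; rewrite ?t_size.
move=> f_real [a [[fa a_min] a_nreal]].
(* Reading [n] as [n - 0] selects [m = 0]. *)
rewrite -[X in _ `^ (X%:R^-1)]subn0; apply: separation_le; rewrite ?t_size //.
have a_conj : a != conjc a.
  apply: contra a_nreal; case: (a) => x y; rewrite complex_real => /eqP[].
  by move=> yE; apply/eqP; lra.
have fa' := root_conjc _ _ _ f_real fa; rewrite -!t_root in fa fa'.
apply: le_trans (t_sep _ _ fa fa' a_conj) _; apply: le_trans (normcB_le _ _ _) _.
(* The distance from [a] to its conjugate is at most [2 * |a|], and minimality of [a] gives
   [|a| <= |t_0|]. *)
rewrite normc_conj -mulr2n mulr_natl lerMn2r /=; apply: a_min.
by rewrite -t_root mem_nth // t_size ltnW.
Qed.
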